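(* The SONC cone $C_{n,2d}$ is preserved under the following operations. (i) (Diagonal scaling) Let $\mathbf{a}\in\mathbb{R}^n$ with $a_i\neq0$ for all $i$, and let $T_{\mathbf{a}}$ be the linear isomorphism $T_{\mathbf{a}}f(\mathbf{x})=f(a_1x_1,\dots,a_nx_n)$. Then $T_{\mathbf{a}}$ leaves $C_{n,2d}$ invariant, i.e. $T_{\mathbf{a}}f\in C_{n,2d}$ for all $f\in C_{n,2d}$. (ii) (Nonnegative linear variable identification/projection) Let $p_1,\dots,p_r\in\{1,\dots,n\}$ be distinct indices, $q_1,\dots,q_r\in\{1,\dots,n\}$, and $k_1,\dots,k_r\ge0$ real. If $f\in C_{n,2d}$, then the polynomial obtained from $f$ by the simultaneous substitution $x_{p_i}=k_ix_{q_i}$, $i=1,\dots,r$, is SONC, i.e. lies in $C_{n,2d}$. (iii) (Constant restriction) Let $I\subseteq\{1,\dots,n\}$ and $r_i\in\mathbb{R}$ for $i\in I$. If $f\in C_{n,2d}$, then the polynomial obtained from $f$ by setting $x_i=r_i$ for $i\in I$ is SONC, i.e. lies in $C_{n,2d}$ (regarded as a polynomial not involving the variables $x_i$, $i\in I$).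
   Context: $\mathbb{R}[\mathbf{x}]_{n,2d}$ is the space of real polynomials in $n$ variables of degree at most $2d$; $\mathbb{N}$ contains $0$. SONC cone: A circuit $(S,\boldsymbol\beta)$ consists of a finite affinely independent set $S\subseteq\mathbb{N}^n$ and a point $\boldsymbol\beta\in\mathbb{N}^n\setminus S$ in the relative interior of $\mathrm{conv}(S)$. A monomial square is a term $c\,\mathbf{x}^{\boldsymbol\alpha}$ with $c\ge0$ and $\boldsymbol\alpha\in 2\mathbb{N}^n$. A circuit polynomial is a polynomial that is either a sum of monomial squares or of the form $\sum_{\boldsymbol\alpha\in S}c_{\boldsymbol\alpha}\mathbf{x}^{\boldsymbol\alpha}+\delta\,\mathbf{x}^{\boldsymbol\beta}$ with $(S,\boldsymbol\beta)$ a circuit, $S\subseteq 2\mathbb{N}^n$, all $c_{\boldsymbol\alpha}>0$ and $\delta\in\mathbb{R}$. A polynomial is SONC if it is a finite conic combination of circuit polynomials that are nonnegative on $\mathbb{R}^n$. $C_{n,2d}$ is the cone of all SONC polynomials in $\mathbb{R}[\mathbf{x}]_{n,2d}$. *)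

(* Defs.v *)
From mathcomp Require Import all_boot all_order all_algebra.
(* mpoly must be imported before topology: their notations clash otherwise. *)
From mathcomp Require Import finmap mpoly.
From mathcomp Require Import classical_sets reals topology normedtype.

Set Implicit Arguments.
Unset Strict Implicit.
Unset Printing Implicit Defensive.

Import Order.TTheory GRing.Theory Num.Theory.
Import numFieldTopology.Exports.

Local Open Scope classical_set_scope.
Local Open Scope ring_scope.

Definition affine_hull (R : realType) (n : nat) (A : set 'rV[R]_n) :
    set 'rV[R]_n :=
  [set y | exists (k : nat) (v : 'I_k -> 'rV[R]_n) (mu : 'I_k -> R),
    [/\ forall i, A (v i), \sum_i mu i = 1 & y = \sum_i mu i *: v i]].

Definition convex_hull (R : realType) (n : nat) (A : set 'rV[R]_n) :
    set 'rV[R]_n :=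
  [set y | exists (k : nat) (v : 'I_k -> 'rV[R]_n) (mu : 'I_k -> R),
    [/\ forall i, A (v i), forall i, 0 <= mu i, \sum_i mu i = 1
      & y = \sum_i mu i *: v i]].

(* Interior of A in the topology of its affine hull. *)
Definition relative_interior (R : realType) (n : nat) (A : set 'rV[R]_n) :
    set 'rV[R]_n :=
  [set x | A x /\ \forall y \near x, affine_hull A y -> A y].

Definition expvec (R : realType) (n : nat) (m : 'X_{1..n}) : 'rV[R]_n :=
  \row_i (m i)%:R.

Definition affinely_independent (R : realType) (n : nat)
    (S : {fset 'X_{1..n}}) : Prop :=
  forall mu : 'X_{1..n} -> R,
    \sum_(m <- S) mu m = 0 -> \sum_(m <- S) mu m *: expvec R m = 0 ->
    forall m, m \in S -> mu m = 0.

Definition circuit (R : realType) (n : nat) (S : {fset 'X_{1..n}})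
    (b : 'X_{1..n}) : Prop :=
  [/\ affinely_independent R S, b \notin S
    & relative_interior (convex_hull [set expvec R m | m in [set` S]])
        (expvec R b)].

Definition even_mnm (n : nat) (m : 'X_{1..n}) : Prop :=
  forall i, ~~ odd (m i).

Definition monomial_square (R : realType) (n : nat) (p : {mpoly R[n]}) :
    Prop :=
  exists (c : R) (m : 'X_{1..n}),
    [/\ 0 <= c, even_mnm m & p = c *: 'X_[m]].

Definition circuit_polynomial (R : realType) (n : nat) (p : {mpoly R[n]}) :
    Prop :=
  (exists (k : nat) (t : 'I_k -> {mpoly R[n]}),
      (forall i, monomial_square (t i)) /\ p = \sum_i t i)
  \/
  (exists (S : {fset 'X_{1..n}}) (b : 'X_{1..n}) (c : 'X_{1..n} -> R)
      (delta : R),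
    [/\ circuit R S b,
        forall m, m \in S -> even_mnm m,
        forall m, m \in S -> 0 < c m
      & p = \sum_(m <- S) c m *: 'X_[m] + delta *: 'X_[b]]).

Definition nonneg_poly (R : realType) (n : nat) (p : {mpoly R[n]}) : Prop :=
  forall x : 'I_n -> R, 0 <= p.@[x].

Definition SONC (R : realType) (n : nat) (f : {mpoly R[n]}) : Prop :=
  exists (k : nat) (g : 'I_k -> {mpoly R[n]}) (lambda : 'I_k -> R),
    [/\ forall i, circuit_polynomial (g i), forall i, nonneg_poly (g i),
        forall i, 0 <= lambda i & f = \sum_i lambda i *: g i].

(* [msize] is one more than the total degree (and [msize 0 = 0]), so the bound
   says deg f <= D; it is imposed on f only, not on the summands. *)
Definition SONC_cone (R : realType) (n D : nat) : set {mpoly R[n]} :=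
  [set f | SONC f /\ (msize f <= D.+1)%N].
Arguments SONC_cone : clear implicits.

(* f(s_0, ..., s_(n-1)), all variables being substituted simultaneously. *)
Definition substitute (R : realType) (n : nat) (s : 'I_n -> {mpoly R[n]})
    (f : {mpoly R[n]}) : {mpoly R[n]} :=
  comp_mpoly [tuple s j | j < n] f.

Definition diag_scaling (R : realType) (n : nat) (a : 'I_n -> R) :
    {mpoly R[n]} -> {mpoly R[n]} :=
  substitute (fun j => a j *: 'X_j).

(* The choice made by [pick] is immaterial, since p is injective in the
   intended uses. *)
Definition identify_vars (R : realType) (n r : nat) (p q : 'I_r -> 'I_n)
    (k : 'I_r -> R) : {mpoly R[n]} -> {mpoly R[n]} :=
  substitute (fun j =>
    if [pick i | p i == j] is Some i then k i *: 'X_(q i) else 'X_j).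

Definition restrict_vars (R : realType) (n : nat) (I : {set 'I_n})
    (r : 'I_n -> R) : {mpoly R[n]} -> {mpoly R[n]} :=
  substitute (fun j => if j \in I then (r j)%:MP else 'X_j).

(* Main.v *)
Require Import Defs.
From mathcomp Require Import all_boot all_order all_algebra.
From mathcomp Require Import finmap mpoly.
From mathcomp Require Import boolp classical_sets reals topology normedtype.
From mathcomp Require Import sequences exp.
From mathcomp Require Import lra ring.

Set Implicit Arguments.
Unset Strict Implicit.
Unset Printing Implicit Defensive.

Import Order.TTheory GRing.Theory Num.Theory.
Import numFieldNormedType.Exports.
Local Open Scope classical_set_scope.
Local Open Scope ring_scope.

(** The three operations replace every variable x_j by a term c_j x^(e_j),
where e_j is a unit vector or 0.  Such a substitution sends terms to terms, and
terms with an even exponent and a nonnegative coefficient to terms of the same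
kind, without raising the degree.  Since it is linear and the SONC polynomials
form a convex cone, only the images of nonnegative circuit polynomials matter.
The difficulty is that the induced linear map on exponents may merge vertices
of a circuit or make them affinely dependent, so the image of a circuit
polynomial need not be one.

The remedy is a certificate of nonnegativity that forgets affine independence.
Consider the forms
  sum_i lam_i e^(w_i) x^(a_i) + eps x^b
with a_i even, lam_i >= 0, sum_i lam_i = 1 and sum_i lam_i a_i = b.  By the
weighted inequality of arithmetic and geometric means such a form is nonnegative
as soon as |eps| <= e^(sum_i lam_i w_i) ([amgm_nonneg]).  Three facts then give
the theorem.

- A nonnegative circuit polynomial is a sum of monomial squares or satisfies
  this bound: affine independence gives a point where the ratios of the terms
  c_i x^(a_i) are those of the weights lam_i, so that the inequality of means
  is an equality there ([nonneg_circuit_certificate]).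

- The bound survives the substitution: the weights are kept, a_i and b are
  mapped linearly, and w_i grows by the pairing of a_i with the vector of the
  ln |c_j|, whose weighted mean is the pairing of b with that vector.  If
  c^b = 0, only monomial squares remain ([substitute_circuit_SONC]).

- Every form that satisfies the bound is SONC ([amgm_form_SONC]).  When the a_i
  of positive weight are affinely dependent, the dependency nu writes lam as a
  convex combination of two vectors lam + t1 nu and lam - t2 nu of smaller
  support, and convexity of exp shows that eps can be shared between the two
  halves within their bounds.  By induction on the support, the a_i end up
  affinely independent, with b as a strict barycenter: either there is a single
  a_i, equal to b, and the form is a monomial square, or they form a circuit
  with inner point b.

The link between strictly positive weights and the relative interior that
occurs in the definition of a circuit is made by barycentric coordinates, which
are continuous affine functions ([circuit_weights], [circuit_of_weights]). *)

(** * The cone of SONC polynomials *)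

Lemma SONC_sum (R : realType) (n : nat) (I : Type) (s : seq I) (P : pred I)
    (F : I -> {mpoly R[n]}) :
  (forall i, P i -> SONC (F i)) -> SONC (\sum_(i <- s | P i) F i).
Proof.
move=> FS; apply: (big_ind (@SONC R n)) => //.
  exists 0%N, (fun=> 0), (fun=> 0); split=> [[]|[]|[]|] //.
  by rewrite big_ord0.
move=> f g [k1 [g1 [l1 [g1c g1p l1p ->]]]] [k2 [g2 [l2 [g2c g2p l2p ->]]]].
exists (k1 + k2)%N,
  (fun i => match split i with inl j => g1 j | inr j => g2 j end),
  (fun i => match split i with inl j => l1 j | inr j => l2 j end).
split=> [i|i|i|]; [by case: split..|].
rewrite big_split_ord /=; congr (_ + _); apply: eq_bigr => i _.
  by rewrite (unsplitK (inl i)).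
by rewrite (unsplitK (inr i)).
Qed.

Lemma SONC_add (R : realType) (n : nat) (f g : {mpoly R[n]}) :
  SONC f -> SONC g -> SONC (f + g).
Proof.
move=> fS gS; have := @SONC_sum R n bool [:: true; false] xpredT
  (fun b => if b then f else g).
by rewrite !big_cons big_nil addr0; apply=> -[].
Qed.

Lemma SONC_scale (R : realType) (n : nat) (c : R) (f : {mpoly R[n]}) :
  0 <= c -> SONC f -> SONC (c *: f).
Proof.
move=> c0 [k [g [l [gc gp lp ->]]]]; exists k, g, (fun i => c * l i).
split=> // [i|]; first by rewrite mulr_ge0.
by rewrite scaler_sumr; apply: eq_bigr => i _; rewrite scalerA.
Qed.

Lemma circuit_polynomial_SONC (R : realType) (n : nat) (f : {mpoly R[n]}) :
  circuit_polynomial f -> nonneg_poly f -> SONC f.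
Proof.
move=> fc fp; exists 1%N, (fun=> f), (fun=> 1); split=> //.
by rewrite big_ord1 scale1r.
Qed.

Lemma monomial_even_ge0 (R : realType) (n : nat) (m : 'X_{1..n})
    (x : 'I_n -> R) :
  even_mnm m -> 0 <= ('X_[m]).@[x].
Proof.
by move=> me; rewrite mevalX; apply: prodr_ge0 => i _; rewrite exprn_even_ge0.
Qed.

Lemma monomial_square_SONC (R : realType) (n : nat) (c : R) (m : 'X_{1..n}) :
  0 <= c -> even_mnm m -> SONC (c *: 'X_[m]).
Proof.
move=> c0 me; apply: circuit_polynomial_SONC => [|x].
  left; exists 1%N, (fun=> c *: 'X_[m]); split; last by rewrite big_ord1.
  by move=> _; exists c, m.
by rewrite mevalZ mulr_ge0 ?monomial_even_ge0.
Qed.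

(** * Barycentric coordinates on an affinely independent set of exponents *)

(** The matrix with rows (1, m), for m in S, has independent rows, hence a right
inverse, which solves the system. *)
Lemma affine_interpolation (R : realType) (n : nat) (S : {fset 'X_{1..n}}) :
  affinely_independent R S -> forall g : 'X_{1..n} -> R,
  exists (k : R) (u : 'I_n -> R),
    forall m, m \in S -> k + \sum_j (m j)%:R * u j = g m.
Proof.
move=> indS g; set s := enum_fset S; pose N := size s.
have us : uniq s by apply: fset_uniq.
pose z := 0%MM : 'X_{1..n}.
pose A : 'M[R]_(N, 1 + n) := \matrix_(i < N) row_mx 1%:M (expvec R (nth z s i)).
have /row_freeP[B AB] : row_free A.
  apply: inj_row_free => v vA.
  pose mu m := if insub (index m s) is Some i then v 0 (i : 'I_N) else 0.
  have muE (i : 'I_N) : mu (nth z s i) = v 0 i.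
    by rewrite /mu index_uniq // valK.
  have vA0 j : \sum_i v 0 i * A i j = 0.
    by have := congr1 (fun M : 'rV_(1 + n) => M 0 j) vA; rewrite !mxE.
  apply/rowP => i; rewrite -muE mxE; apply: indS; last exact: mem_nth.
    rewrite (big_nth z) big_mkord -[RHS](vA0 (lshift n 0)).
    by apply: eq_bigr => l _; rewrite muE mxE row_mxEl mxE mulr1.
  rewrite (big_nth z) big_mkord; apply/rowP => j.
  rewrite summxE [RHS]mxE -[RHS](vA0 (rshift 1 j)).
  by apply: eq_bigr => l _; rewrite muE [A l _]mxE row_mxEr mxE.
pose G : 'cV[R]_N := \col_i g (nth z s i).
pose W := B *m G.
exists (W (lshift n 0) 0), (fun j => W (rshift 1 j) 0) => m mS.
have im : (index m s < N)%N by rewrite index_mem.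
have := congr1 (fun M : 'cV_N => M (Ordinal im) 0) (mulmxA A B G).
rewrite AB mul1mx [RHS]mxE nth_index // => <-.
rewrite [RHS]mxE big_split_ord /= big_ord1; congr (_ + _).
  by rewrite [A _ _]mxE row_mxEl [1%:M _ _]mxE mul1r.
apply: eq_bigr => j _.
by rewrite [A _ _]mxE row_mxEr [expvec _ _ _ _]mxE nth_index.
Qed.

(** Each coordinate interpolates the indicator function of a point of S. *)
Lemma barycentric_coordinates (R : realType) (n : nat) (S : {fset 'X_{1..n}}) :
  affinely_independent R S ->
  exists phi : 'X_{1..n} -> 'rV[R]_n -> R,
    [/\ forall m, continuous (phi m),
        forall m k (v : 'I_k -> 'rV[R]_n) (mu : 'I_k -> R), \sum_i mu i = 1 ->
          phi m (\sum_i mu i *: v i) = \sum_i mu i * phi m (v i)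
      & forall m m', m' \in S -> phi m (expvec R m') = (m' == m)%:R].
Proof.
move=> indS.
have /choice[k /choice[u ku]] : forall m, exists k : R, exists u : 'I_n -> R,
    forall m', m' \in S -> k + \sum_j (m' j)%:R * u j = (m' == m)%:R.
  move=> m.
  have [k [u ku]] := affine_interpolation indS (fun m' => (m' == m)%:R).
  by exists k, u => m' /ku.
exists (fun m y => k m + \sum_j y 0 j * u m j); split.
- move=> m.
  have sumC : continuous (fun y : 'rV[R]_n => \sum_j y 0 j * u m j).
    apply: (@continuous_big R _ +%R 0 xpredT) => [|j _ z].
      exact: (@add_continuous R).
    exact: (cvgM (@coord_continuous R 1 n 0 j z) (cvg_cst (u m j))).
  move=> y; exact: (cvgD (cvg_cst (k m)) (sumC y)).
- move=> m N v mu mu1.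
  have -> : \sum_i mu i * (k m + \sum_j v i 0 j * u m j) =
      \sum_i mu i * k m + \sum_i mu i * \sum_j v i 0 j * u m j.
    by rewrite -big_split; apply: eq_bigr => i _; rewrite mulrDr.
  rewrite -mulr_suml mu1 mul1r; congr (_ + _).
  under [RHS]eq_bigr do rewrite mulr_sumr.
  rewrite exchange_big; apply: eq_bigr => j _; rewrite summxE mulr_suml.
  by apply: eq_bigr => i _; rewrite mxE mulrA.
- move=> m m' m'S; rewrite -(ku m m' m'S); congr (_ + _).
  by apply: eq_bigr => j _; rewrite mxE.
Qed.

(** Both identities hold at the points of S and pass to affine combinations. *)
Lemma affine_hull_barycentric (R : realType) (n : nat) (S : {fset 'X_{1..n}})
    (phi : 'X_{1..n} -> 'rV[R]_n -> R) (y : 'rV[R]_n) :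
  (forall m k (v : 'I_k -> 'rV[R]_n) (mu : 'I_k -> R), \sum_i mu i = 1 ->
     phi m (\sum_i mu i *: v i) = \sum_i mu i * phi m (v i)) ->
  (forall m m', m' \in S -> phi m (expvec R m') = (m' == m)%:R) ->
  affine_hull (convex_hull [set expvec R m | m in [set` S]]) y ->
  \sum_(m <- S) phi m y = 1 /\ \sum_(m <- S) phi m y *: expvec R m = y.
Proof.
move=> aphi dphi.
pose Q y := \sum_(m <- S) phi m y = 1 /\
            \sum_(m <- S) phi m y *: expvec R m = y.
have Qaff k (v : 'I_k -> 'rV[R]_n) (mu : 'I_k -> R) :
    (forall i, Q (v i)) -> \sum_i mu i = 1 -> Q (\sum_i mu i *: v i).
  move=> Qv mu1; split.
    under eq_bigr do rewrite aphi //.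
    rewrite exchange_big /= -[RHS]mu1; apply: eq_bigr => i _.
    by rewrite -mulr_sumr (Qv i).1 mulr1.
  under eq_bigr do rewrite aphi // scaler_suml.
  rewrite exchange_big /=; apply: eq_bigr => i _; rewrite -[in RHS](Qv i).2.
  by rewrite scaler_sumr; apply: eq_bigr => m _; rewrite scalerA.
have Qconv v : convex_hull [set expvec R m | m in [set` S]] v -> Q v.
  move=> [k [w [mu [wS _ mu1 ->]]]]; apply: Qaff => // i.
  have [m mS <-] := wS i.
  have off m' : m' != m -> phi m' (expvec R m) = 0.
    by move=> m'm; rewrite dphi // eq_sym (negPf m'm).
  split; rewrite (bigD1_seq m) ?fset_uniq //= dphi // eqxx ?scale1r
    big1 ?addr0 //.
  by move=> m' /off ->; rewrite scale0r.
by move=> [k [v [mu [vS mu1 ->]]]]; apply: Qaff => // i; exact: Qconv.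
Qed.

Lemma affine_path_cvg (R : realType) (a b : R) :
  (1 + t) * a - t * b @[t --> (0 : R)] --> a.
Proof.
have -> : (fun t => (1 + t) * a - t * b) = (fun t => a + t * (a - b)).
  by apply/funext => t; rewrite mulrDl mul1r mulrBr addrA.
have idC : id t @[t --> (0 : R)] --> (0 : R) by exact: cvg_id.
have := cvgD (cvg_cst a) (cvgMr_tmp (b := a - b) idC).
by rewrite mul0r addr0; apply.
Qed.

(** The weights are the barycentric coordinates of b.  If the one of a vertex m
vanished, the points b + t (b - m) with t > 0 would have a negative coordinate,
so no neighbourhood of b in the affine hull would lie in the convex hull. *)
Lemma circuit_weights (R : realType) (n : nat) (S : {fset 'X_{1..n}})
    (b : 'X_{1..n}) :
  circuit R S b ->
  exists lam : 'X_{1..n} -> R,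
    [/\ forall m, m \in S -> 0 < lam m, \sum_(m <- S) lam m = 1
      & forall j, \sum_(m <- S) lam m * (m j)%:R = (b j)%:R].
Proof.
case=> /barycentric_coordinates[phi [cphi aphi dphi]] _ [bconv bint].
have conv_ge0 y m : m \in S ->
    convex_hull [set expvec R m | m in [set` S]] y -> 0 <= phi m y.
  move=> mS [k [v [mu [vS mu0 mu1 ->]]]]; rewrite aphi //.
  apply: sumr_ge0 => i _; rewrite mulr_ge0 //.
  by have [m' m'S <-] := vS i; rewrite dphi.
have aff_conv y : affine_hull [set expvec R m | m in [set` S]] y ->
    affine_hull (convex_hull [set expvec R m | m in [set` S]]) y.
  move=> [k [v [mu [vS mu1 ->]]]]; exists k, v, mu; split=> // i.
  exists 1%N, (fun=> v i), (fun=> 1); split=> //; first by rewrite big_ord1.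
  by rewrite big_ord1 scale1r.
have baff : affine_hull [set expvec R m | m in [set` S]] (expvec R b).
  by have [k [v [mu [vS _ mu1 bE]]]] := bconv; exists k, v, mu.
have [sum1 sumb] := affine_hull_barycentric aphi dphi (aff_conv _ baff).
exists (fun m => phi m (expvec R b)); split=> // [m mS|j]; last first.
  have := congr1 (fun M : 'rV_n => M 0 j) sumb; rewrite summxE [RHS]mxE => <-.
  by apply: eq_bigr => m _; rewrite !mxE.
rewrite lt_neqAle conv_ge0 // andbT; apply/eqP => phi0.
pose y (t : R) := (1 + t) *: expvec R b - t *: expvec R m.
have yb : y t @[t --> (0 : R)] --> expvec R b.
  move=> A [P Pb PA]; rewrite nbhs_simpl /=.
  have : \forall t \near (0 : R), forall i j, P i j (y t i j).
    apply: (filter_forall (F := nbhs (0 : R))) => i.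
    apply: (filter_forall (F := nbhs (0 : R))) => j.
    pose c t := (1 + t) * expvec R b i j - t * expvec R m i j.
    suff : \forall t \near (0 : R), P i j (c t).
      by apply: filterS => t; rewrite /y /c !mxE.
    by apply: (affine_path_cvg _ (Pb i j)).
  by apply: filterS => t; exact: PA.
have yaff t : affine_hull [set expvec R m | m in [set` S]] (y t) /\
    phi m (y t) = - t.
  have [k [v [mu [vS mu1 bE]]]] := baff.
  pose v' (i : 'I_k.+1) := if unlift ord0 i is Some j then v j else expvec R m.
  pose mu' (i : 'I_k.+1) :=
    if unlift ord0 i is Some j then (1 + t) * mu j else - t.
  have mu'1 : \sum_i mu' i = 1.
    rewrite big_ord_recl /mu' unlift_none.
    under eq_bigr do rewrite liftK.
    by rewrite -mulr_sumr mu1; ring.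
  have yE : y t = \sum_i mu' i *: v' i.
    rewrite big_ord_recl /mu' /v' unlift_none.
    under eq_bigr do rewrite liftK -scalerA.
    by rewrite -scaler_sumr -bE /y scaleNr addrC.
  split; first exists k.+1, v', mu'.
    split=> // i; rewrite /v'; case: (unlift ord0 i) => [j|]; first exact: vS.
    by exists m.
  rewrite yE aphi // big_ord_recl /mu' /v' unlift_none dphi // eqxx mulr1.
  under eq_bigr do rewrite liftK -mulrA.
  by rewrite -mulr_sumr -aphi // -bE -phi0 mulr0 addr0.
have /nbhs_ballP[e /= e0 ballP] := yb _ bint.
have he0 : 0 < e / 2 by rewrite divr_gt0.
have [/aff_conv ya phiE] := yaff (e / 2).
suff : 0 <= phi m (y (e / 2)) by rewrite phiE; lra.
apply: conv_ge0 => //; apply: ballP ya.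
by rewrite -ball_normE /ball_ /= sub0r normrN gtr0_norm //; lra.
Qed.

(** The barycentric coordinates are positive at b, hence near b by continuity,
and on the affine hull they are the weights of a convex combination. *)
Lemma circuit_of_weights (R : realType) (n : nat) (S : {fset 'X_{1..n}})
    (b : 'X_{1..n}) (lam : 'X_{1..n} -> R) :
  affinely_independent R S -> b \notin S ->
  (forall m, m \in S -> 0 < lam m) -> \sum_(m <- S) lam m = 1 ->
  (forall j, \sum_(m <- S) lam m * (m j)%:R = (b j)%:R) ->
  circuit R S b.
Proof.
move=> indS bS lam0 lam1 lamb; split=> //.
have [phi [cphi aphi dphi]] := barycentric_coordinates indS.
pose z := 0%MM : 'X_{1..n}.
have sumS (V : nmodType) (F : 'X_{1..n} -> V) :
    \sum_(m <- S) F m = \sum_(i < size (enum_fset S)) F (nth z (enum_fset S) i).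
  by rewrite (big_nth z) big_mkord.
have nthS (i : 'I_(size (enum_fset S))) : nth z (enum_fset S) i \in S.
  exact: mem_nth.
have bE : expvec R b = \sum_(m <- S) lam m *: expvec R m.
  apply/rowP => j; rewrite mxE -lamb summxE.
  by apply: eq_bigr => m _; rewrite !mxE.
have phib m : m \in S -> phi m (expvec R b) = lam m.
  move=> mS; rewrite bE sumS aphi -?sumS //.
  rewrite -(sumS _ (fun m' => lam m' * phi m (expvec R m'))).
  rewrite (bigD1_seq m) ?fset_uniq //= dphi // eqxx mulr1.
  rewrite big_seq_cond big1 ?addr0 // => m' /andP[m'S /negPf m'm].
  by rewrite dphi // m'm mulr0.
have conv_of_ge0 y :
    affine_hull (convex_hull [set expvec R m | m in [set` S]]) y ->
    (forall m, m \in S -> 0 < phi m y) ->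
    convex_hull [set expvec R m | m in [set` S]] y.
  move=> /(affine_hull_barycentric aphi dphi)[phi1 phiy] phi0.
  exists (size (enum_fset S)), (fun i => expvec R (nth z (enum_fset S) i)),
    (fun i => phi (nth z (enum_fset S) i) y).
  split; [|by move=> i; rewrite ltW ?phi0|by rewrite -phi1 sumS|].
    by move=> i; exists (nth z (enum_fset S) i); rewrite //= nthS.
  by rewrite -[LHS]phiy sumS.
split.
  exists (size (enum_fset S)), (fun i => expvec R (nth z (enum_fset S) i)),
    (fun i => lam (nth z (enum_fset S) i)).
  split; [|by move=> i; rewrite ltW ?lam0|by rewrite -lam1 sumS|].
    by move=> i; exists (nth z (enum_fset S) i); rewrite //= nthS.
  by rewrite bE sumS.
have : \forall y \near expvec R b, forall m : S, 0 < phi (val m) y.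
  apply: (filter_forall (F := nbhs (expvec R b))) => m.
  apply: (cvgr_gt _ (cphi (val m) _)).
  by rewrite phib ?lam0 // fsvalP.
apply: filterS => y phi0 ya; apply: conv_of_ge0 => // m mS.
exact: (phi0 [` mS]%fset).
Qed.

(** * Certificates from the inequality of weighted means *)

Definition pairing (R : realType) (n : nat) (m : 'X_{1..n})
    (u : 'I_n -> R) : R :=
  \sum_j (m j)%:R * u j.

Definition convex_weights (R : realType) (n : nat) (I : finType)
    (lam : I -> R) (a : I -> 'X_{1..n}) (b : 'X_{1..n}) : Prop :=
  [/\ forall i, 0 <= lam i, \sum_i lam i = 1
    & forall j, \sum_i lam i * (a i j)%:R = (b j)%:R].

(** Writing the coefficients as lam i * expR (w i) makes the bound of the
inequality of means, prod_i (c_i / lam_i)^(lam_i), linear in the exponent: it is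
the exponential of sum_i lam_i w_i. *)
Definition amgm_form (R : realType) (n : nat) (I : finType)
    (a : I -> 'X_{1..n}) (b : 'X_{1..n}) (lam w : I -> R) (eps : R) :
    {mpoly R[n]} :=
  \sum_i (lam i * expR (w i)) *: 'X_[a i] + eps *: 'X_[b].

Lemma convex_weights_pairing (R : realType) (n : nat) (I : finType)
    (lam : I -> R) (a : I -> 'X_{1..n}) (b : 'X_{1..n}) (u : 'I_n -> R) :
  convex_weights lam a b -> \sum_i lam i * pairing (a i) u = pairing b u.
Proof.
case=> _ _ lamb; under eq_bigr do rewrite mulr_sumr.
rewrite exchange_big; apply: eq_bigr => j _; rewrite -lamb mulr_suml.
by apply: eq_bigr => i _; rewrite mulrA.
Qed.

(** The exponents are nonnegative, so nothing cancels in the barycenter b. *)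
Lemma convex_weights_support (R : realType) (n : nat) (I : finType)
    (lam : I -> R) (a : I -> 'X_{1..n}) (b : 'X_{1..n}) (i : I) (j : 'I_n) :
  convex_weights lam a b -> lam i != 0 -> a i j != 0%N -> b j != 0%N.
Proof.
case=> lam0 _ lamb li aij; rewrite -(pnatr_eq0 R) -lamb gt_eqF //.
rewrite (bigD1 i) //= ltr_wpDr //; last first.
  by rewrite mulr_gt0 ?ltr0n ?lt0n // lt0r li lam0.
by apply: sumr_ge0 => k _; rewrite mulr_ge0.
Qed.

(** Sum the tangent line inequalities of expR at the mean. *)
Lemma expR_jensen (R : realType) (I : finType) (lam s : I -> R) :
  (forall i, 0 <= lam i) -> \sum_i lam i = 1 ->
  expR (\sum_i lam i * s i) <= \sum_i lam i * expR (s i).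
Proof.
move=> lam0 lam1; set t := \sum_i _.
have -> : expR t = \sum_i lam i * (expR t * (1 + (s i - t))).
  have -> : \sum_i lam i * (expR t * (1 + (s i - t))) =
      \sum_i (expR t * (1 - t) * lam i + expR t * (lam i * s i)).
    by apply: eq_bigr => i _; ring.
  by rewrite big_split -!mulr_sumr lam1 -/t /=; ring.
apply: ler_sum => i _; apply: ler_wpM2l => //.
have {2}-> : s i = t + (s i - t) by ring.
by rewrite expRD ler_wpM2l ?expR_ge0 // expR_ge1Dx.
Qed.

(** Variables of exponent zero may vanish: [ln 0] is then multiplied by 0. *)
Lemma norm_monomial_expR (R : realType) (n : nat) (m : 'X_{1..n})
    (x : 'I_n -> R) :
  (forall j, m j != 0%N -> x j != 0) ->
  `|('X_[m]).@[x]| = expR (pairing m (fun j => ln `|x j|)).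
Proof.
move=> x0; rewrite mevalX normr_prod expR_sum; apply: eq_bigr => j _.
rewrite normrX expRM_natl; have [->//|/x0 xj0] := eqVneq (m j) 0%N.
by rewrite lnK // posrE normr_gt0.
Qed.

Lemma monomial_neq0 (R : realType) (n : nat) (m : 'X_{1..n}) (x : 'I_n -> R) :
  ('X_[m]).@[x] != 0 -> forall j, m j != 0%N -> x j != 0.
Proof.
rewrite mevalX => /prodf_neq0 xm j mj.
by have := xm j isT; rewrite expf_eq0 lt0n mj.
Qed.

(** Where x^b does not vanish, x^(a_i) is e^(pairing (a i) u) with u = ln |x|,
and Jensen's inequality bounds the sum below by e^(sum_i lam_i w_i) |x^b|. *)
Lemma amgm_nonneg (R : realType) (n : nat) (I : finType)
    (a : I -> 'X_{1..n}) (b : 'X_{1..n}) (lam w : I -> R) (eps : R) :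
  (forall i, lam i != 0 -> even_mnm (a i)) -> convex_weights lam a b ->
  `|eps| <= expR (\sum_i lam i * w i) ->
  nonneg_poly (amgm_form a b lam w eps).
Proof.
move=> ae lamC epsE x; have [lam0 lam1 _] := lamC.
rewrite mevalD raddf_sum mevalZ /=; under eq_bigr do rewrite mevalZ.
have [->|xb] := eqVneq (('X_[b]).@[x]) 0.
  rewrite mulr0 addr0; apply: sumr_ge0 => i _.
  have [->|/ae/monomial_even_ge0 e] := eqVneq (lam i) 0.
    by rewrite !mul0r.
  by rewrite !mulr_ge0 ?expR_ge0.
have xN := monomial_neq0 xb; pose u j := ln `|x j|.
have -> : \sum_i lam i * expR (w i) * ('X_[a i]).@[x] =
    \sum_i lam i * expR (w i + pairing (a i) u).
  apply: eq_bigr => i _.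
  have [->|li] := eqVneq (lam i) 0; first by rewrite !mul0r.
  rewrite expRD -norm_monomial_expR ?mulrA.
    by rewrite ger0_norm // monomial_even_ge0 //; exact: ae.
  by move=> j /(convex_weights_support lamC li); exact: xN.
have := expR_jensen (fun i => w i + pairing (a i) u) lam0 lam1.
under eq_bigr do rewrite mulrDr.
rewrite big_split /= (convex_weights_pairing u lamC) expRD.
rewrite -norm_monomial_expR // => J.
have : `|eps * ('X_[b]).@[x]| <= \sum_i lam i * expR (w i + pairing (a i) u).
  by apply: le_trans J; rewrite normrM ler_wpM2r.
by rewrite ler_norml => /andP[+ _]; rewrite lerNl -subr_ge0 opprK.
Qed.

(** * Splitting a certificate into circuits *)

Lemma sum_delta (R : realType) (I : finType) (i : I) (F : I -> R) :
  \sum_k (k == i)%:R * F k = F i.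
Proof.
rewrite (bigD1 i) //= eqxx mul1r big1 ?addr0 // => k /negPf ->.
by rewrite mul0r.
Qed.

(** Move along nu until a first weight vanishes. *)
Lemma push_weights (R : realType) (I : finType) (lam nu : I -> R) :
  (forall i, 0 <= lam i) -> (forall i, lam i = 0 -> nu i = 0) ->
  (exists i, nu i < 0) ->
  exists t : R, [/\ 0 < t, forall i, 0 <= lam i + t * nu i
    & exists2 i, lam i != 0 & lam i + t * nu i = 0].
Proof.
move=> lam0 sup [i0 i0N].
case: (@arg_minP _ _ _ i0 (fun i => nu i < 0) (fun i => lam i / - nu i) i0N).
move=> k kN kmin; have lk : lam k != 0.
  by apply/eqP => /sup nuk; rewrite nuk ltxx in kN.
have nk0 : nu k != 0 by rewrite lt_eqF.
exists (lam k / - nu k); split.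
- by rewrite divr_gt0 ?oppr_gt0 // lt0r lk lam0.
- move=> i; have [iN|iP] := ltP (nu i) 0; last first.
    by rewrite addr_ge0 // mulr_ge0 // divr_ge0 // oppr_ge0 ltW.
  have := kmin i iN; rewrite ler_pdivlMr ?oppr_gt0 // => h; lra.
- by exists k => //; field.
Qed.

(** The hypothesis on nu says that the a_i of positive weight are affinely
independent; it also makes them distinct.  If b is one of them, independence
leaves only that weight and the form is one monomial square.  Otherwise the form
is a circuit polynomial. *)
Lemma amgm_form_independent_SONC (R : realType) (n : nat) (I : finType)
    (a : I -> 'X_{1..n}) (b : 'X_{1..n}) (lam w : I -> R) (eps : R) :
  (forall i, lam i != 0 -> even_mnm (a i)) -> convex_weights lam a b ->
  `|eps| <= expR (\sum_i lam i * w i) ->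
  (forall nu : I -> R, (forall i, lam i = 0 -> nu i = 0) -> \sum_i nu i = 0 ->
     (forall j, \sum_i nu i * (a i j)%:R = 0) -> forall i, nu i = 0) ->
  SONC (amgm_form a b lam w eps).
Proof.
move=> ae lamC epsE ind; have [lam0 lam1 lamb] := lamC.
have [/existsP[i /andP[li /eqP ai]]|/existsPn noi] :=
    boolP [exists i, (lam i != 0) && (a i == b)].
  have lamE k : lam k = (k == i)%:R.
    apply/eqP; rewrite -subr_eq0; apply/eqP.
    apply: (ind (fun k => lam k - (k == i)%:R)) => [l l0|/=|j].
    - by case: eqP => [li'|_]; [rewrite -li' l0 eqxx in li|rewrite l0 subr0].
    - rewrite sumrB lam1 (bigD1 i) //= eqxx big1 ?addr0 ?subrr //.
      by move=> l /negPf->.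
    - under eq_bigr do rewrite mulrBl.
      rewrite sumrB lamb (bigD1 i) //= eqxx mul1r ai big1 ?addr0 ?subrr //.
      by move=> l /negPf->; rewrite mul0r.
  have sumi (V : lmodType R) (F : I -> V) : \sum_k lam k *: F k = F i.
    rewrite (bigD1 i) //= lamE eqxx scale1r big1 ?addr0 // => k /negPf ki.
    by rewrite lamE ki scale0r.
  rewrite /amgm_form; under eq_bigr do rewrite -scalerA.
  rewrite sumi ai -scalerDl.
  apply: monomial_square_SONC; last by rewrite -ai; exact: ae.
  have := epsE; rewrite (sumi R^o w) ler_norml => /andP[h _].
  by rewrite -lerBlDl sub0r.
pose D := [pred i | lam i != 0].
have ainj : {in D &, injective a}.
  move=> i k; rewrite !inE => li lk aik; apply/eqP; apply: contraT => ik.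
  have sum1 l : \sum_k (k == l)%:R = 1 :> R.
    by rewrite (bigD1 l) //= eqxx big1 ?addr0 // => h /negPf ->.
  have nu0 : (i == i)%:R - (i == k)%:R = 0 :> R.
    apply: (ind (fun l => (l == i)%:R - (l == k)%:R)) => [l l0|/=|j].
    - have off h : lam h != 0 -> (l == h) = false.
        by move=> lh; apply/negbTE; apply: contra_neq lh => <-.
      by rewrite !off // subrr.
    - by rewrite sumrB !sum1 subrr.
    - under eq_bigr do rewrite mulrBl.
      by rewrite sumrB !sum_delta aik subrr.
  by move: nu0; rewrite eqxx (negPf ik) subr0 => /eqP; rewrite oner_eq0.
pose S : {fset 'X_{1..n}} := [fset a i | i in D]%fset.
have memS i : lam i != 0 -> a i \in S.
  by move=> li; apply/imfsetP; exists i.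
have Smem m : m \in S -> exists2 i, lam i != 0 & m = a i.
  by move=> /imfsetP[i /= iD ->]; exists i.
have sumS (V : nmodType) (F : 'X_{1..n} -> V) :
    \sum_(m <- S) F m = \sum_(i | lam i != 0) F (a i).
  rewrite big_imfset /=; last by move=> i k iD kD; exact: ainj.
  by rewrite big_enum; apply: eq_bigl => i; rewrite inE.
(* the coefficients carried over to the exponents through the injection a *)
pose c (F : I -> R) m := \sum_(i | (lam i != 0) && (a i == m)) F i.
have cE F i : lam i != 0 -> c F (a i) = F i.
  move=> li; rewrite /c (bigD1 i) /= ?li ?eqxx // big1 ?addr0 //.
  by move=> k /andP[/andP[lk /eqP aki] /eqP]; case; exact: ainj.
have support_sum (V : nmodType) (F : I -> V) :
    (forall i, lam i = 0 -> F i = 0) ->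
    \sum_(i | lam i != 0) F i = \sum_i F i.
  move=> F0; rewrite [RHS](bigID (fun i => lam i != 0)) /=.
  rewrite [X in _ + X]big1 ?addr0 //.
  by move=> i; rewrite negbK => /eqP; exact: F0.
have formE : amgm_form a b lam w eps =
    \sum_(m <- S) c (fun i => lam i * expR (w i)) m *: 'X_[m] + eps *: 'X_[b].
  rewrite sumS /amgm_form; congr (_ + _).
  rewrite -support_sum => [|i ->]; last by rewrite mul0r scale0r.
  by apply: eq_bigr => i li; rewrite cE.
apply: circuit_polynomial_SONC; last exact: amgm_nonneg.
right; exists S, b, (c (fun i => lam i * expR (w i))), eps; split=> //.
- apply: (circuit_of_weights (lam := c lam)).
  + move=> mu mu1 mub m /Smem[i li ->].
    pose nu i := if lam i == 0 then 0 else mu (a i).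
    have nuE k : lam k != 0 -> nu k = mu (a k) by rewrite /nu => /negPf->.
    rewrite -nuE //; apply: ind => [k lk|/=|j]; first by rewrite /nu lk eqxx.
      rewrite -[RHS]mu1 sumS -(support_sum _ nu) => [|k lk]; last first.
        by rewrite /nu lk eqxx.
      by apply: eq_bigr => k; exact: nuE.
    have := congr1 (fun M : 'rV_n => M 0 j) mub; rewrite /= mxE summxE => mubj.
    rewrite -[RHS]mubj sumS.
    rewrite -(support_sum _ (fun k => nu k * (a k j)%:R)) => [|k lk]; last first.
      by rewrite /nu lk eqxx mul0r.
    by apply: eq_bigr => k lk; rewrite nuE // !mxE.
  + by apply/negP => /Smem[i li bE]; have := noi i; rewrite li -bE eqxx.
  + by move=> m /Smem[i li ->]; rewrite cE // lt0r li lam0.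
  + rewrite -[RHS]lam1 sumS -(support_sum _ lam) //.
    by apply: eq_bigr => i; exact: cE.
  + move=> j; rewrite -lamb sumS.
    rewrite -(support_sum _ (fun i => lam i * (a i j)%:R)) => [|i ->]; last first.
      by rewrite mul0r.
    by apply: eq_bigr => i li; rewrite cE.
- by move=> m /Smem[i li ->]; exact: ae.
- by move=> m /Smem[i li ->]; rewrite cE // mulr_gt0 ?expR_gt0 // lt0r li lam0.
Qed.

(** Induction on the number of positive weights.  A dependency nu has entries of
both signs, since its sum is 0, so that the weights can be pushed to smaller
supports in the directions nu and - nu. *)
Lemma amgm_form_SONC (R : realType) (n : nat) (I : finType)
    (a : I -> 'X_{1..n}) (b : 'X_{1..n}) (w : I -> R) :
  forall (lam : I -> R) (eps : R),
  (forall i, lam i != 0 -> even_mnm (a i)) -> convex_weights lam a b ->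
  `|eps| <= expR (\sum_i lam i * w i) ->
  SONC (amgm_form a b lam w eps).
Proof.
move=> lam; have [N] := ubnP #|[pred i | lam i != 0]|.
elim: N lam => // N IH lam suppN eps ae lamC epsE.
have [ind|] := pselect (forall nu : I -> R, (forall i, lam i = 0 -> nu i = 0) ->
    \sum_i nu i = 0 -> (forall j, \sum_i nu i * (a i j)%:R = 0) ->
    forall i, nu i = 0).
  exact: amgm_form_independent_SONC.
move=> /existsNP[nu /not_implyP[sup /not_implyP[nu1 /not_implyP[nub]]]].
move=> /existsNP[i0 /eqP nui0]; have [lam0 lam1 lamb] := lamC.
have step (nu' : I -> R) : (forall i, lam i = 0 -> nu' i = 0) ->
    \sum_i nu' i = 0 -> (forall j, \sum_i nu' i * (a i j)%:R = 0) ->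
    (exists i, nu' i != 0) ->
    exists t, 0 < t /\ forall eps',
      `|eps'| <= expR (\sum_i (lam i + t * nu' i) * w i) ->
      SONC (amgm_form a b (fun i => lam i + t * nu' i) w eps').
  move=> sup' nu1' nub' [i1 nui1].
  have neg : exists i, nu' i < 0.
    apply/not_existsP => pos; case/negP: nui1.
    have pos' i : 0 <= nu' i by rewrite leNgt; apply/negP/pos.
    move/eqP: nu1'; rewrite psumr_eq0 // => /allP/(_ i1).
    by rewrite mem_index_enum; apply.
  have [t [t0 lt0 [k lk ltk]]] := push_weights lam0 sup' neg.
  have suppS i : lam i + t * nu' i != 0 -> lam i != 0.
    by apply: contra_neq => li; rewrite li sup' // mulr0 addr0.
  exists t; split=> // eps' epsE'; apply: IH => // [|i /suppS|]; last 1 first.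
  - split=> // [|j].
      by rewrite big_split /= lam1 -mulr_sumr nu1' mulr0 addr0.
    under eq_bigr do rewrite mulrDl -mulrA.
    by rewrite big_split /= lamb -mulr_sumr nub' mulr0 addr0.
  - apply: (@leq_trans #|[pred i | lam i != 0]|); last by rewrite -ltnS.
    apply: proper_card; apply/properP; split.
      by apply/fintype.subsetP => i; rewrite !inE; exact: suppS.
    by exists k; rewrite !inE // ltk eqxx.
  - exact: ae.
have [t1 [t10 S1]] := step nu sup nu1 nub (ex_intro _ i0 nui0).
have [t2 [t20 S2]] : exists t, 0 < t /\ forall eps',
      `|eps'| <= expR (\sum_i (lam i + t * - nu i) * w i) ->
      SONC (amgm_form a b (fun i => lam i + t * - nu i) w eps').
  apply: (step (fun i => - nu i)) => [i /sup->||j|].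
  - by rewrite oppr0.
  - by rewrite sumrN nu1 oppr0.
  - by under eq_bigr do rewrite mulNr; rewrite sumrN nub oppr0.
  - by exists i0; rewrite oppr_eq0.
set l1 := fun i => lam i + t1 * nu i in S1.
set l2 := fun i => lam i + t2 * - nu i in S2.
(* lam lies between l1 and l2, and mu holds its two barycentric coordinates *)
pose mu (c : bool) := if c then t2 / (t1 + t2) else t1 / (t1 + t2).
pose s (c : bool) := \sum_i (if c then l1 i else l2 i) * w i.
have t12 : t1 + t2 != 0 by rewrite gt_eqF // addr_gt0.
have mu0 c : 0 <= mu c by case: c; rewrite divr_ge0 ?addr_ge0 ?ltW.
have mu1 : \sum_c mu c = 1 by rewrite big_bool /mu /=; field.
have lamE i : lam i = mu true * l1 i + mu false * l2 i.
  by rewrite /mu /l1 /l2 /=; field.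
have sE : \sum_i lam i * w i = \sum_c mu c * s c.
  rewrite big_bool /s /= !mulr_sumr -big_split /=; apply: eq_bigr => i _.
  by rewrite {1}lamE mulrDl !mulrA.
set E := \sum_c mu c * expR (s c).
have epsE1 : `|eps| <= E.
  by apply: le_trans (expR_jensen s mu0 mu1); rewrite -sE.
have E0 : 0 < E.
  by apply: lt_le_trans (expR_jensen s mu0 mu1); exact: expR_gt0.
(* eps is shared between the two halves in proportion to their bounds *)
have share c : `|eps * (expR (s c) / E)| <= expR (s c).
  rewrite normrM (ger0_norm (divr_ge0 (expR_ge0 _) (ltW E0))).
  by rewrite mulrA ler_pdivrMr // mulrC ler_wpM2l ?expR_ge0.
have -> : amgm_form a b lam w eps =
    mu true *: amgm_form a b l1 w (eps * (expR (s true) / E)) +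
    mu false *: amgm_form a b l2 w (eps * (expR (s false) / E)).
  rewrite /amgm_form !scalerDr addrACA !scalerA -scalerDl; congr (_ + _).
    rewrite !scaler_sumr -big_split /=; apply: eq_bigr => i _.
    by rewrite !scalerA -scalerDl {1}lamE mulrDl !mulrA.
  congr (_ *: _).
  have -> : mu true * (eps * (expR (s true) / E)) +
      mu false * (eps * (expR (s false) / E)) = eps * (E / E).
    by rewrite {3}/E big_bool /=; ring.
  by rewrite divff ?mulr1 ?gt_eqF.
apply: SONC_add; apply: SONC_scale => //; [apply: S1|apply: S2]; exact: share.
Qed.

(** * From nonnegative circuit polynomials to certificates *)

(** Affine interpolation gives u with w m + pairing m u constant on S.  At the
point e^u, with signs chosen such that delta x^b is negative, all terms of the
first sum are proportional to their weights, and nonnegativity there is exactly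
the bound on delta. *)
Lemma nonneg_circuit_certificate (R : realType) (n : nat) (S : {fset 'X_{1..n}})
    (b : 'X_{1..n}) (c : 'X_{1..n} -> R) (delta : R) :
  circuit R S b -> (forall m, m \in S -> even_mnm m) ->
  (forall m, m \in S -> 0 < c m) ->
  nonneg_poly (\sum_(m <- S) c m *: 'X_[m] + delta *: 'X_[b]) ->
  (0 <= delta /\ even_mnm b) \/
  exists lam w : S -> R,
    [/\ convex_weights lam val b, forall m, c (val m) = lam m * expR (w m)
      & `|delta| <= expR (\sum_m lam m * w m)].
Proof.
move=> Sb Se c0 f0; have [indS _ _] := Sb.
have [delta_b|ndelta_b] := pselect (0 <= delta /\ even_mnm b); [by left|right].
have [lam [lam0 lam1 lamb]] := circuit_weights Sb.
pose w m := ln (c m / lam m).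
have cE m : m \in S -> c m = lam m * expR (w m).
  move=> mS; rewrite lnK ?posrE ?divr_gt0 ?c0 ?lam0 //.
  by rewrite mulrC divfK // gt_eqF ?lam0.
have lamC : convex_weights (fun m : S => lam (val m)) val b.
  split=> [m||j]; [by rewrite ltW ?lam0 ?fsvalP|..].
    by rewrite -[RHS]lam1 big_seq_fsetE.
  by rewrite -lamb big_seq_fsetE.
exists (fun m => lam (val m)), (fun m => w (val m)); split=> //.
  by move=> m; rewrite cE ?fsvalP.
have [k [u ku]] := affine_interpolation indS (fun m => - w m).
have wE m : m \in S -> w m + pairing m u = - k.
  by move=> mS; have := ku m mS; rewrite -/(pairing m u) => h; lra.
set s := \sum_m _.
have sbk : s + pairing b u = - k.
  rewrite -(convex_weights_pairing u lamC) -big_split /=.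
  have -> : - k = \sum_(m : S) lam (val m) * - k.
    by rewrite -mulr_suml; have [_ -> _] := lamC; rewrite mul1r.
  by apply: eq_bigr => m _; rewrite -mulrDr wE ?fsvalP.
(* when delta > 0, some b j is odd, and the sign of that variable is flipped *)
have [sg [sg1 sgb]] : exists sg : 'I_n -> R, (forall j, `|sg j| = 1) /\
    delta * ('X_[b]).@[sg] = - `|delta|.
  have [dP|dN] := ltP 0 delta; last first.
    exists (fun=> 1); split=> [j|]; first exact: normr1.
    rewrite mevalX big1 ?mulr1 => [|j _]; last exact: expr1n.
    by rewrite ler0_norm // opprK.
  have [j jodd] : exists j, odd (b j).
    apply/not_existsP => be; apply: ndelta_b; split; first exact: ltW.
    by move=> j; apply/negP/be.
  exists (fun i => if i == j then -1 else 1); split=> [i|].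
    by case: ifP => _; rewrite ?normrN normr1.
  rewrite mevalX (bigD1 j) //= eqxx big1 => [|i /negPf->]; last exact: expr1n.
  by rewrite -signr_odd jodd expr1 mulr1 mulrN1 gtr0_norm.
pose x j := sg j * expR (u j).
have xE m : ('X_[m]).@[x] = ('X_[m]).@[sg] * expR (pairing m u).
  rewrite !mevalX expR_sum -big_split /=; apply: eq_bigr => j _.
  by rewrite exprMn expRM_natl.
have sgE m : even_mnm m -> ('X_[m]).@[sg] = 1.
  move=> me; rewrite mevalX big1 // => j _.
  by rewrite -[sg j ^+ _]ger0_norm ?exprn_even_ge0 ?me // normrX sg1 expr1n.
have := f0 x; rewrite mevalD raddf_sum mevalZ /= xE mulrA sgb.
have -> : \sum_(m <- S) (c m *: 'X_[m]).@[x] = expR (- k).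
  rewrite -[RHS]mul1r -lam1 mulr_suml; apply: eq_big_seq => m mS.
  by rewrite mevalZ xE sgE ?mul1r; [rewrite cE // -mulrA -expRD wE|exact: Se].
rewrite -sbk expRD -mulrDl.
by rewrite pmulr_lge0 ?expR_gt0 // subr_ge0.
Qed.

(** * Substituting a term for each variable *)

Section MonomialSubstitution.

Variables (R : realType) (n : nat) (c : 'I_n -> R) (e : 'I_n -> 'X_{1..n}).

Let s (j : 'I_n) : {mpoly R[n]} := c j *: 'X_[e j].

(** The linear map on exponents that the substitution induces. *)
Let L (m : 'X_{1..n}) : 'X_{1..n} := (\sum_j e j *+ m j)%MM.

Lemma substitute_monomial m : substitute s 'X_[m] = ('X_[m]).@[c] *: 'X_[L m].
Proof.
rewrite /substitute comp_mpolyX mevalX.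
under eq_bigr do rewrite tnth_mktuple exprZn mpolyXn.
rewrite scaler_prod; congr (_ *: _).
rewrite (big_morph (fun m => 'X_[m] : {mpoly R[n]})
  (@mpolyXD _ _) (@mpolyX0 _ _)) //.
Qed.

Lemma image_exponentE m i : L m i = (\sum_j e j i * m j)%N.
Proof. by rewrite mnm_sumE; apply: eq_bigr => j _; rewrite mulmnE. Qed.

Lemma even_image_exponent m : even_mnm m -> even_mnm (L m).
Proof.
move=> me i; rewrite image_exponentE.
apply: (big_ind (fun k => ~~ odd k)) => [//|k l /negPf kE /negPf lE|j _].
  by rewrite oddD kE lE.
by rewrite oddM negb_and me orbT.
Qed.

Lemma substitute_square k m : 0 <= k -> even_mnm m ->
  SONC (substitute s (k *: 'X_[m])).
Proof.
move=> k0 me; rewrite /substitute comp_mpolyZ -/(substitute _ _).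
rewrite substitute_monomial scalerA; apply: monomial_square_SONC.
  by rewrite mulr_ge0 ?monomial_even_ge0.
exact: even_image_exponent.
Qed.

(** The w of the certificate absorbs the factors c^m = e^(pairing m v), where
v = ln |c|.  This is where c^b <> 0 is needed; it implies c^m <> 0 for every m
of positive weight. *)
Lemma substitute_circuit_SONC g :
  circuit_polynomial g -> nonneg_poly g -> SONC (substitute s g).
Proof.
move=> [[k [t [tsq ->]]] _|[S [b [d [delta [Sb Se d0 ->]]]]] g0].
  rewrite /substitute raddf_sum /=; apply: SONC_sum => i _.
  by have [q [m [q0 me ->]]] := tsq i; exact: substitute_square.
have squares : SONC (substitute s (\sum_(m <- S) d m *: 'X_[m])).
  rewrite /substitute raddf_sum /= big_seq; apply: SONC_sum => m mS.
  by apply: substitute_square; [exact/ltW/d0|exact: Se].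
have [[delta0 be]|[lam [w [lamC dE deltaE]]]] :=
    nonneg_circuit_certificate Sb Se d0 g0.
  rewrite /substitute comp_mpolyD; apply: SONC_add => //.
  exact: substitute_square.
have [cb0|cb] := eqVneq (('X_[b]).@[c]) 0.
  rewrite /substitute comp_mpolyD; apply: SONC_add => //.
  rewrite comp_mpolyZ -/(substitute s _) substitute_monomial cb0 scale0r scaler0.
  rewrite -(scale0r 'X_[0%MM]).
  by apply: monomial_square_SONC => // i; rewrite mnm0E.
pose v j := ln `|c j|.
have -> : substitute s (\sum_(m <- S) d m *: 'X_[m] + delta *: 'X_[b]) =
    amgm_form (fun m : S => L (val m)) (L b) lam
      (fun m => w m + pairing (val m) v) (delta * ('X_[b]).@[c]).
  rewrite /substitute comp_mpolyD raddf_sum comp_mpolyZ /= -/(substitute s _).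
  rewrite substitute_monomial scalerA /amgm_form; congr (_ + _).
  rewrite big_seq_fsetE; apply: eq_bigr => m _ /=.
  rewrite comp_mpolyZ -/(substitute s _) substitute_monomial scalerA dE.
  congr (_ *: _); rewrite expRD mulrA.
  have [->|lm] := eqVneq (lam m) 0; first by rewrite !mul0r.
  rewrite -norm_monomial_expR ?ger0_norm //.
    by apply: monomial_even_ge0; apply: Se; exact: fsvalP.
  by move=> j /(convex_weights_support lamC lm); exact: (monomial_neq0 cb).
apply: amgm_form_SONC.
- by move=> m _; apply: even_image_exponent; apply: Se; exact: fsvalP.
- have [lam0 lam1 lamb] := lamC; split=> // i.
  rewrite image_exponentE natr_sum.
  under [LHS]eq_bigr do rewrite image_exponentE natr_sum mulr_sumr.
  rewrite exchange_big; apply: eq_bigr => j _; rewrite natrM -lamb mulr_sumr.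
  by apply: eq_bigr => m _; rewrite natrM mulrCA.
- rewrite normrM (norm_monomial_expR (monomial_neq0 cb)) -/v.
  under eq_bigr do rewrite mulrDr.
  rewrite big_split /= (convex_weights_pairing v lamC) expRD.
  by rewrite ler_wpM2r ?expR_ge0.
Qed.

Lemma substitute_SONC f : SONC f -> SONC (substitute s f).
Proof.
move=> [k [g [l [gc g0 l0 ->]]]]; rewrite /substitute raddf_sum /=.
apply: SONC_sum => i _; rewrite comp_mpolyZ; apply: SONC_scale => //.
exact: substitute_circuit_SONC.
Qed.

Lemma msize_substitute f : (forall j, mdeg (e j) <= 1)%N ->
  (msize (substitute s f) <= msize f)%N.
Proof.
move=> e1; rewrite /substitute comp_mpolyEX.
apply: (leq_trans (msize_sum _ _ _)); apply/bigmax_leqP_seq => m mf _.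
apply: (leq_trans (msizeZ_le _ _)); rewrite -/(substitute s _).
rewrite substitute_monomial; apply: (leq_trans (msizeZ_le _ _)).
rewrite msizeX; apply: leq_trans (msize_mdeg_lt mf); rewrite ltnS.
rewrite mdeg_sum mdegE; apply: leq_sum => j _.
by rewrite mdegMn -[leqRHS]mul1n leq_mul2r e1 orbT.
Qed.

Lemma substitute_SONC_cone D f : (forall j, mdeg (e j) <= 1)%N ->
  SONC_cone R n D f -> SONC_cone R n D (substitute s f).
Proof.
move=> e1 [fS fD]; split; first exact: substitute_SONC.
exact: leq_trans (msize_substitute f e1) fD.
Qed.

End MonomialSubstitution.

(** The form in which the three operations are instances. *)
Lemma substitute_term_SONC_cone (R : realType) (n D : nat)
    (s : 'I_n -> {mpoly R[n]}) (f : {mpoly R[n]}) :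
  (forall j, exists (c : R) (e : 'X_{1..n}),
     (mdeg e <= 1)%N /\ s j = c *: 'X_[e]) ->
  SONC_cone R n D f -> SONC_cone R n D (substitute s f).
Proof.
move=> /choice[c /choice[e ce]] fS.
have -> : s = fun j => c j *: 'X_[e j] by apply/funext => j; exact: (ce j).2.
by apply: substitute_SONC_cone fS => j; exact: (ce j).1.
Qed.

Theorem lemma4p1 (R : realType) (n d : nat) :
  [/\ (* diagonal scaling *)
      forall a : 'I_n -> R, (forall i, a i != 0) ->
        forall f : {mpoly R[n]}, SONC_cone R n (2 * d) f ->
          SONC_cone R n (2 * d) (diag_scaling a f),
      (* nonnegative linear variable identification *)
      forall (r : nat) (p q : 'I_r -> 'I_n) (k : 'I_r -> R),
        injective p -> (forall i, 0 <= k i) ->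
        forall f : {mpoly R[n]}, SONC_cone R n (2 * d) f ->
          SONC_cone R n (2 * d) (identify_vars p q k f)
    & (* constant restriction *)
      forall (I : {set 'I_n}) (r : 'I_n -> R),
        forall f : {mpoly R[n]}, SONC_cone R n (2 * d) f ->
          SONC_cone R n (2 * d) (restrict_vars I r f)].
Proof.
split=> [a _ f|r p q k _ _ f|I r f]; apply: substitute_term_SONC_cone => j.
- by exists (a j), U_(j)%MM; rewrite mdeg1.
- case: pickP => [i _|_].
    by exists (k i), U_(q i)%MM; rewrite mdeg1.
  by exists 1, U_(j)%MM; rewrite mdeg1 scale1r.
- case: ifP => _; last by exists 1, U_(j)%MM; rewrite mdeg1 scale1r.
  by exists (r j), 0%MM; rewrite mdeg0 mpolyX0 alg_mpolyC.
Qed.
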